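(* For any field $k$, there exist regular local $k$-algebras $R$ of positive (Krull) dimension which admit no $k$-linear differential operators of positive order; that is, the natural inclusion $R \hookrightarrow D_k(R)$ (sending $r$ to multiplication by $r$) is an isomorphism.
   Context: For a commutative algebra $S$ over a commutative ring $A$, the $A$-linear differential operators on $S$ are defined inductively: $D^0_A(S)=\mathrm{Hom}_S(S,S)\subseteq \mathrm{Hom}_A(S,S)$, and for $n\ge 1$, $\delta\in \mathrm{Hom}_A(S,S)$ lies in $D^n_A(S)$ if and only if the commutator $[\delta,s]=\delta\circ s-s\circ\delta$ lies in $D^{n-1}_A(S)$ for every $s\in S$ (where $s$ also denotes multiplication by $s$). The ring of differential operators is $D_A(S)=\bigcup_{n\ge 0}D^n_A(S)$, a ring under composition. A regular local ring is in particular Noetherian. *)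

(* Defs.v *)
From HB Require Import structures.
From mathcomp Require Import all_boot all_algebra ring_quotient.
From mathcomp Require Import boolp classical_sets functions.
Set Implicit Arguments.
Unset Strict Implicit.
Unset Printing Implicit Defensive.
Import GRing.Theory.
Local Open Scope ring_scope.

(* Ideals are boolean predicates, as in ring_quotient; with the classical      *)
(* axioms of boolp, {pred R} ranges over all subsets of R. Beware that         *)
(* idealr_closed I includes 1 \notin I, i.e. I is a proper ideal.              *)
Section CommutativeAlgebra.
Variable R : comNzRingType.
Implicit Types (I m : {pred R}) (s : seq R).

Definition generated_by I s : Prop :=
  forall x, x \in I <-> exists c : 'I_(size s) -> R, x = \sum_i c i * s`_i.

(* The unit ideal is generated by 1, so only proper ideals are considered. *)
Definition noetherian : Prop :=
  forall I, idealr_closed I -> exists s, generated_by I s.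

Definition prime_ideal I : Prop := idealr_closed I /\ prime_idealr_closed I.

Definition maximal_ideal m : Prop :=
  idealr_closed m /\
  forall I, idealr_closed I -> {subset m <= I} -> {subset I <= m}.

Definition local_with m : Prop :=
  maximal_ideal m /\ forall m', maximal_ideal m' -> m' =i m.

(* p 0 < p 1 < ... < p n; the values of p beyond n are irrelevant. *)
Definition prime_chain (n : nat) (p : nat -> {pred R}) : Prop :=
  (forall i, (i <= n)%N -> prime_ideal (p i)) /\
  (forall i, (i < n)%N ->
     {subset p i <= p i.+1} /\ ~ {subset p i.+1 <= p i}).

Definition krull_dim (d : nat) : Prop :=
  (exists p, prime_chain d p) /\
  (forall n p, prime_chain n p -> (n <= d)%N).

Definition regular_local : Prop :=
  noetherian /\
  exists m d, [/\ local_with m, krull_dim d &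
                  exists s, size s = d /\ generated_by m s].

End CommutativeAlgebra.

Section DifferentialOperators.
Variables (A : comNzRingType) (S : comAlgType A).
Implicit Types (f g : S -> S) (s : S) (n : nat).

Definition dcomm f s : S -> S := fun x => f (s * x) - s * f x.

(* S^o is S as a module over itself, so the case n = 0 is Hom_S(S, S). *)
Fixpoint diffop_order n f : Prop :=
  if n is n'.+1 then linear f /\ forall s, diffop_order n' (dcomm f s)
  else linear (f : S^o -> S^o).

Definition is_diffop f : Prop := exists n, diffop_order n f.

Lemma diffop_order0M f : diffop_order 0 f -> forall s x, f (s * x) = s * f x.
Proof.
move=> /= f_lin s x; have f0 : f 0 = 0.
  by have := f_lin (-1) 0 0; rewrite !scaleN1r !addNr.
by have := f_lin s x 0; rewrite !addr0 f0 addr0.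
Qed.

Lemma diffop_order_linear n f : diffop_order n f -> linear f.
Proof.
case: n => [f0 a x y|n []] //.
have := f0 1 (a *: x) y; rewrite !scale1r => ->.
by rewrite -mulr_algl (diffop_order0M f0) mulr_algl.
Qed.

Lemma diffop_orderB n f g :
  diffop_order n f -> diffop_order n g -> diffop_order n (f - g).
Proof.
have linB (B : pzRingType) (V : lmodType B) (u v : V -> V) :
    linear u -> linear v -> linear (u - v).
  by move=> ul vl a x y; rewrite !fctE ul vl scalerBr opprD addrACA.
elim: n f g => [|n IHn] f g; first exact: (linB _ S^o).
move=> [fl fc] [gl gc]; split; first exact: linB.
move=> s; have -> : dcomm (f - g) s = dcomm f s - dcomm g s.
  by apply/funext => x; rewrite /dcomm !fctE mulrBr !opprD addrACA.
exact: IHn (fc s) (gc s).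
Qed.

Lemma diffop_order_cst0 n : diffop_order n (0 : S -> S).
Proof.
have fct0 (x : S) : (0 : S -> S) x = 0 by [].
elim: n => [|n IHn]; first by move=> a x y; rewrite !fct0 scaler0 addr0.
split=> [a x y|s]; first by rewrite !fct0 scaler0 addr0.
suff -> : dcomm 0 s = 0 by [].
by apply/funext => x; rewrite /dcomm !fct0 mulr0 subr0.
Qed.

Lemma dcomm_order0 f s : diffop_order 0 f -> dcomm f s = 0.
Proof.
by move=> f0; apply/funext => x; rewrite /dcomm (diffop_order0M f0) subrr.
Qed.

Lemma diffop_orderS n f : diffop_order n f -> diffop_order n.+1 f.
Proof.
elim: n f => [|n IHn] f fn; split; try exact: diffop_order_linear fn.
  by move=> s; rewrite (dcomm_order0 _ fn); apply: (diffop_order_cst0 0).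
by move=> s; apply: IHn; exact: (fn.2 s).
Qed.

Lemma diffop_order_le m n f : (m <= n)%N -> diffop_order m f -> diffop_order n f.
Proof.
by move=> /subnK <- fm; elim: (n - m)%N => // k; apply: diffop_orderS.
Qed.

Lemma diffop_orderN n f : diffop_order n f -> diffop_order n (- f).
Proof. by rewrite -sub0r; apply/diffop_orderB/diffop_order_cst0. Qed.

Lemma diffop_orderD n f g :
  diffop_order n f -> diffop_order n g -> diffop_order n (f + g).
Proof. by move=> fn gn; rewrite -[g]opprK; apply/diffop_orderB/diffop_orderN. Qed.

Lemma diffop_order_comp m n f g :
  diffop_order m f -> diffop_order n g -> diffop_order (m + n) (f \o g).
Proof.
have linC (B : pzRingType) (V : lmodType B) (u v : V -> V) :
    linear u -> linear v -> linear (u \o v).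
  by move=> ul vl a x y; rewrite /= vl ul.
have dcommC f' g' s : linear f' ->
    dcomm (f' \o g') s = (f' \o dcomm g' s) + (dcomm f' s \o g').
  move=> fl; apply/funext => x.
  change (f' (g' (s * x)) - s * f' (g' x) =
          f' (g' (s * x) - s * g' x) + (f' (s * g' x) - s * f' (g' x))).
  have -> : f' (g' (s * x) - s * g' x) = f' (g' (s * x)) - f' (s * g' x).
    by rewrite addrC -scaleN1r fl scaleN1r addrC.
  by rewrite addrA subrK.
elim: m n f g => [|m IHm] n f g fm gn.
  elim: n g gn => [|n IHn] g gn; first exact: (linC _ S^o).
  have fl := diffop_order_linear fm; split; first exact: linC fl gn.1.
  move=> s; rewrite dcommC // (dcomm_order0 _ fm).
  apply: diffop_orderD; last exact: (diffop_order_cst0 n).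
  exact: IHn (gn.2 s).
have [fl fc] := fm.
elim: n g gn => [|n IHn] g gn; rewrite ?addn0 ?addnS ?addSn; split;
  try exact: linC fl (diffop_order_linear gn).
- move=> s; rewrite dcommC // (dcomm_order0 _ gn); apply: diffop_orderD.
    have -> : f \o (0 : S -> S) = (0 : S -> S).
      apply/funext => x; change (f 0 = 0).
      by have := fl (-1) 0 0; rewrite !scaleN1r !addNr.
    exact: diffop_order_cst0.
  by rewrite -[m]addn0; apply: IHm (fc s) gn.
move=> s; rewrite dcommC //; apply: diffop_orderD.
  by rewrite -addSn; apply: IHn (gn.2 s).
by rewrite -addnS; apply: IHm (fc s) gn.
Qed.

Lemma mul_diffop_order0 (r : S) : diffop_order 0 ( *%R r).
Proof. by move=> a x y; rewrite mulrDr /GRing.scale/= mulrCA. Qed.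

Definition is_diffopb : {pred S -> S} := fun f => `[< is_diffop f >].

Lemma is_diffopbP f : reflect (is_diffop f) (f \in is_diffopb).
Proof. exact: asboolP. Qed.

Fact is_diffopb_zmod_closed : zmod_closed is_diffopb.
Proof.
split; first by apply/is_diffopbP; exists 0%N; apply: diffop_order_cst0.
move=> f g /is_diffopbP[m fm] /is_diffopbP[n gn]; apply/is_diffopbP.
exists (maxn m n); apply: diffop_orderB.
  by apply: diffop_order_le fm; apply: leq_maxl.
by apply: diffop_order_le gn; apply: leq_maxr.
Qed.

HB.instance Definition _ :=
  GRing.isZmodClosed.Build (S -> S) is_diffopb is_diffopb_zmod_closed.

(* The ring D_A(S); its multiplication is composition, unlike the pointwise   *)
(* ring structure that the library puts on S -> S.                            *)
Record diffop : Type := Diffop {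
  diffop_fun :> S -> S;
  diffop_funP : diffop_fun \in is_diffopb
}.

HB.instance Definition _ := [isSub for diffop_fun].
HB.instance Definition _ := [Choice of diffop by <:].
HB.instance Definition _ := [SubChoice_isSubZmodule of diffop by <:].

Fact diffop1_subproof : (idfun : S -> S) \in is_diffopb.
Proof. by apply/is_diffopbP; exists 0%N. Qed.

Fact diffop_mul_subproof (f g : diffop) : (f \o g : S -> S) \in is_diffopb.
Proof.
have /is_diffopbP[m fm] := diffop_funP f.
have /is_diffopbP[n gn] := diffop_funP g.
by apply/is_diffopbP; exists (m + n)%N; apply: diffop_order_comp.
Qed.

Definition diffop_one : diffop := Diffop diffop1_subproof.
Definition diffop_mul (f g : diffop) : diffop := Diffop (diffop_mul_subproof f g).

Fact diffop_mulA : associative diffop_mul.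
Proof. by move=> f g h; apply: val_inj. Qed.
Fact diffop_mul1l : left_id diffop_one diffop_mul.
Proof. by move=> f; apply: val_inj. Qed.
Fact diffop_mul1r : right_id diffop_one diffop_mul.
Proof. by move=> f; apply: val_inj. Qed.
Fact diffop_mulDl : left_distributive diffop_mul +%R.
Proof. by move=> f g h; apply: val_inj. Qed.
Fact diffop_mulDr : right_distributive diffop_mul +%R.
Proof.
move=> f g h; apply: val_inj; apply/funext => x /=.
have /is_diffopbP[n /diffop_order_linear fl] := diffop_funP f.
by have := fl 1 (g x) (h x); rewrite !scale1r.
Qed.
Fact diffop_oner_neq0 : diffop_one != 0.
Proof.
apply/eqP => /(congr1 (fun f : diffop => f 1)) /= /eqP.
by rewrite (negPf (oner_neq0 S)).
Qed.

HB.instance Definition _ := GRing.Zmodule_isNzRing.Build diffop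
  diffop_mulA diffop_mul1l diffop_mul1r diffop_mulDl diffop_mulDr
  diffop_oner_neq0.

Fact diffop_of_subproof (r : S) : *%R r \in is_diffopb.
Proof. by apply/is_diffopbP; exists 0%N; apply: mul_diffop_order0. Qed.

Definition diffop_of (r : S) : diffop := Diffop (diffop_of_subproof r).

Fact diffop_of_is_zmod_morphism : zmod_morphism diffop_of.
Proof. by move=> r s; apply: val_inj; apply/funext => x /=; apply: mulrBl. Qed.

Fact diffop_of_is_monoid_morphism : monoid_morphism diffop_of.
Proof.
split=> [|r s]; apply: val_inj; apply/funext => x /=; first exact: mul1r.
by rewrite mulrA.
Qed.

HB.instance Definition _ :=
  GRing.isZmodMorphism.Build S diffop diffop_of diffop_of_is_zmod_morphism.
HB.instance Definition _ :=
  GRing.isMonoidMorphism.Build S diffop diffop_of diffop_of_is_monoid_morphism.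

End DifferentialOperators.

(* Main.v *)
(* Since D^n is defined by commutators, D^1 = D^0 forces D^n = D^0 for all n,
   and D^1 = D^0 holds as soon as there are no nonzero derivations. Take
   u = sum_n t^(n! + n) in k[[t]] and let R be the intersection of k[[t]] with
   the field k(t, u). It is a discrete valuation ring with uniformizer t, and by
   t-adic continuity a derivation D of R satisfies t D(f) = D(t) theta(f), where
   theta = t d/dt. If D(t) is nonzero, then theta(u) is in k(t, u). The gaps
   between the exponents exclude this: a relation Q(u) theta(u) = P(u) would give
   (e_n Y + r_n) Q(Y) = P(Y) in k[t][Y] for all large n, with e_n = n! + n, so
   e_(n+1) - e_n = n! n + 1 would vanish in k for all large n. *)
Require Import Defs.
From HB Require Import structures.
From mathcomp Require Import all_boot all_algebra ring_quotient ring zify.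
From mathcomp Require Import boolp functions.
Set Implicit Arguments.
Unset Strict Implicit.
Unset Printing Implicit Defensive.
Import GRing.Theory.
Local Open Scope ring_scope.

(** * Discrete valuation rings presented by a uniformizer *)

(** These clauses characterise discrete valuation rings; that [R] is a domain is derived in
    [uniformizer_domain]. *)
Definition uniformizer (R : comNzRingType) (t : R) : Prop :=
  [/\ forall w, t * w != 1, forall n, t ^+ n != 0 &
      forall f, f != 0 -> exists n v w, f = t ^+ n * v /\ v * w = 1].

Section Uniformizer.
Variables (R : comNzRingType) (t : R).
Hypothesis t_unif : uniformizer t.

Let m : {pred R} := fun f => `[< exists g, f = t * g >].

Let mP f : reflect (exists g, f = t * g) (f \in m).
Proof. exact: asboolP. Qed.

Lemma uniformizer_domain (f g : R) : f * g = 0 -> f = 0 \/ g = 0.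
Proof.
have [_ tX tf] := t_unif.
have [-> _|/tf[a [v [v' [-> vv']]]]] := eqVneq f 0; first by left.
have [-> _|/tf[b [w [w' [-> ww']]]]] := eqVneq g 0; first by right.
move=> fg0; have /eqP[] := tX (a + b)%N; rewrite exprD.
have -> : t ^+ a * t ^+ b = (t ^+ a * v * (t ^+ b * w)) * (v' * w').
  transitivity (t ^+ a * t ^+ b * (v * v') * (w * w')); last by ring.
  by rewrite vv' ww' !mulr1.
by rewrite fg0 mul0r.
Qed.

Lemma ideal_mull (I : {pred R}) a f : idealr_closed I -> f \in I -> a * f \in I.
Proof. by case=> I0 _ IM fI; rewrite -[_ * _]addr0 IM. Qed.

Let m_ideal : idealr_closed m.
Proof.
have [tV _ _] := t_unif; split.
- by apply/mP; exists 0; rewrite mulr0.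
- by apply/mP => -[g /esym/eqP]; apply/negP.
move=> a _ _ /mP[f ->] /mP[g ->]; apply/mP; exists (a * f + g); ring.
Qed.

(** An element outside [m] is a unit, and [idealr_closed] forces [I] to be proper. *)
Let sub_m (I : {pred R}) : idealr_closed I -> {subset I <= m}.
Proof.
move=> I_ideal f fI; apply/mP; have [_ _ tf] := t_unif.
have [->|/tf[[|n] [v [w [def_f vw]]]]] := eqVneq f 0.
- by exists 0; rewrite mulr0.
- have [_ /negP I1 _] := I_ideal; case: I1.
  by rewrite -vw mulrC -[v]mul1r -(expr0 t) -def_f ideal_mull.
by exists (t ^+ n * v); rewrite mulrA -exprS.
Qed.

Let prime_m : prime_ideal m.
Proof.
have [_ _ tf] := t_unif; split=> // f g /mP[h fg]; apply/orP.
have [f0|/tf[[|n] [v [w [def_f vw]]]]] := eqVneq f 0.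
- by left; rewrite f0; apply/mP; exists 0; rewrite mulr0.
- right; apply/mP; exists (w * h).
  by rewrite mulrCA -fg def_f expr0 mul1r mulrA [w * v]mulrC vw mul1r.
by left; apply/mP; exists (t ^+ n * v); rewrite def_f mulrA -exprS.
Qed.

Let local_m : local_with m.
Proof.
split=> [|I [I_ideal I_max]]; first by split=> // I /sub_m.
by move=> x; apply/idP/idP; [apply: sub_m | apply/I_max => //; apply: sub_m].
Qed.

(** Since [f] is a unit times some t^n, the ideal contains t^n and, being prime, [t]. *)
Let prime_eq_m (I : {pred R}) f :
  prime_ideal I -> f \in I -> f != 0 -> {subset m <= I}.
Proof.
move=> [I_ideal I_prime] fI f0 _ /mP[g ->]; rewrite mulrC ideal_mull //.
have [_ _ /(_ _ f0)[n [v [w [def_f vw]]]]] := t_unif.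
have : t ^+ n \in I.
  by rewrite -[_ ^+ _]mulr1 -vw mulrA -def_f mulrC ideal_mull.
elim: n {def_f} => [|n IHn]; last by rewrite exprS => /I_prime/orP[].
by case: I_ideal => _ /negP I1 _ /I1.
Qed.

Lemma uniformizer_krull_dim : krull_dim R 1.
Proof.
have [tV tX tf] := t_unif; split=> [|n p [p_prime p_lt]].
  pose z : {pred R} := fun f => f == 0; have zE f : (f \in z) = (f == 0) by [].
  exists (fun i => if i is 0 then z else m); split=> [[|[|//]] _|[|//] _].
  - split=> [|f g]; first split; rewrite ?zE ?eqxx ?oner_neq0 //.
      by move=> a u v; rewrite !zE => /eqP-> /eqP->; rewrite mulr0 addr0.
    by move=> /eqP/uniformizer_domain[]->; rewrite eqxx ?orbT.
  - exact: prime_m.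
  split=> [f|/(_ t)]; first by rewrite zE => /eqP->; case: m_ideal.
  rewrite zE => /(_ _)/eqP t0; have := tX 1%N; rewrite expr1 t0 ?eqxx //.
  by apply/mP; exists 1; rewrite mulr1.
(* If n > 1, then [p 1], not being contained in [p 0], has a nonzero element; so it contains [m] and
   hence [p 2], a contradiction. *)
rewrite leqNgt; apply/negP => n_gt1.
have [_] := p_lt 0%N (ltnW n_gt1); apply=> f f1.
have [->|f_neq0] := eqVneq f 0; first by case: (p_prime 0%N isT) => -[].
have [_ []] := p_lt 1%N n_gt1.
have p1 := p_prime 1%N (ltnW n_gt1).
move=> g /sub_m-/(_ (p_prime _ n_gt1).1); exact: prime_eq_m p1 f1 f_neq0 g.
Qed.

(** A nonzero ideal is generated by the power of [t] of least exponent in it. *)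
Lemma uniformizer_noetherian : noetherian R.
Proof.
move=> I I_ideal; have [tV tX tf] := t_unif.
have [[f [fI f0]]|I0] := pselect (exists f, f \in I /\ f != 0); last first.
  exists [::] => f; split=> [fI|[c ->]]; last by rewrite big_ord0; case: I_ideal.
  exists (fun=> 0); rewrite big_ord0; apply/eqP/negP => /negP f0.
  by apply: I0; exists f.
have XI g n v w : g \in I -> g = t ^+ n * v -> v * w = 1 -> t ^+ n \in I.
  move=> gI def_g vw.
  by rewrite -[_ ^+ _]mulr1 -vw mulrA -def_g mulrC ideal_mull.
have : exists n, t ^+ n \in I.
  by have [n [v [w [def_f vw]]]] := tf f f0; exists n; apply: XI def_f vw.
case/ex_minnP=> n nI n_min; exists [:: t ^+ n] => g.
split=> [gI|[c ->]]; last by rewrite big_ord1 ideal_mull.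
have [->|/tf[a [v [w [def_g vw]]]]] := eqVneq g 0.
  by exists (fun=> 0); rewrite big_ord1 mul0r.
have le_na : (n <= a)%N by apply: n_min; apply: XI def_g vw.
exists (fun=> t ^+ (a - n) * v).
by rewrite big_ord1 mulrAC -exprD subnK // -def_g.
Qed.

Lemma uniformizer_regular_local : regular_local R.
Proof.
split; first exact: uniformizer_noetherian.
exists m, 1%N; split=> //; first exact: uniformizer_krull_dim.
exists [:: t]; split=> // f; split=> [/mP[g ->]|[c ->]].
  by exists (fun=> g); rewrite big_ord1 mulrC.
by apply/mP; exists (c ord0); rewrite big_ord1 mulrC.
Qed.

End Uniformizer.

(** * Reduction of differential operators to derivations *)

Section OrderOneOperators.
Variables (A : comNzRingType) (S : comAlgType A).

Definition derivation (D : S -> S) : Prop :=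
  linear D /\ forall x y, D (x * y) = x * D y + y * D x.

Hypothesis no_derivation : forall D : S -> S, derivation D -> D =1 \0.

(** By induction every commutator [f, x] is S-linear, hence multiplication by [f, x](1) = f(x) - x
    f(1). As a function of x this value is a derivation, so it vanishes and [f] is multiplication by
    f(1). *)
Lemma diffop_order_no_derivation n (f : S -> S) :
  diffop_order n f -> diffop_order 0 f.
Proof.
elim: n f => [//|n IHn] f [f_lin /(_ _)/IHn f_comm].
have fM x y : f (x * y) - x * f y = (f x - x * f 1) * y.
  have := diffop_order0M (f_comm x) y 1.
  by rewrite /dcomm !mulr1 => ->; rewrite mulrC.
have D0 : derivation (fun x => f x - x * f 1).
  split=> [a x y|x y].
    by rewrite f_lin scalerBr mulrDl scalerAl opprD addrACA.
  have /eqP := fM x y; rewrite subr_eq => /eqP->; ring.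
suff -> : f = *%R (f 1) by apply: mul_diffop_order0.
by apply/funext => x; apply/eqP; rewrite mulrC -subr_eq0 (no_derivation D0).
Qed.

Lemma diffop_of_no_derivation_bij :
  bijective (@diffop_of A S : {rmorphism S -> diffop S}).
Proof.
exists (fun f : diffop S => f 1) => [r|f]; first by rewrite /= mulr1.
apply: val_inj; apply/funext => x /=.
have /is_diffopbP[n /diffop_order_no_derivation f0] := diffop_funP f.
by rewrite mulrC -(diffop_order0M f0) mulr1.
Qed.

End OrderOneOperators.

(* A copy of [nat -> R], whose library product is the pointwise one. *)
Definition fps (R : Type) : Type := nat -> R.

(** * The ring of formal power series *)

Section PowerSeriesRing.
Variable R : comNzRingType.

HB.instance Definition _ := GRing.Lmodule.copy (fps R) (nat -> R^o).

Implicit Types (f g h : fps R) (p q : {poly R}) (n : nat).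

Lemma fpsD f g n : (f + g) n = f n + g n. Proof. by []. Qed.
Lemma fpsN f n : (- f) n = - f n. Proof. by []. Qed.
Lemma fpsZ a f n : (a *: f) n = a * f n. Proof. by []. Qed.

Definition fps_of (p : {poly R}) : fps R := fun n => p`_n.
Definition fps_trunc (N : nat) (f : fps R) : {poly R} := \poly_(i < N.+1) f i.
(** Going through truncations lets associativity and commutativity be inherited from [{poly R}]: by
    [eq_coefM], coefficient n of a product sees only coefficients up to n. *)
Definition fps_mul f g : fps R := fun n => (fps_trunc n f * fps_trunc n g)`_n.

Lemma coef_fps_trunc N f i : (i <= N)%N -> (fps_trunc N f)`_i = f i.
Proof. by move=> iN; rewrite coef_poly ltnS iN. Qed.

Lemma eq_coefM n (p q p' q' : {poly R}) :
    (forall i, (i <= n)%N -> p`_i = p'`_i) ->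
    (forall i, (i <= n)%N -> q`_i = q'`_i) ->
  (p * q)`_n = (p' * q')`_n.
Proof.
move=> pp' qq'; rewrite !coefM; apply: eq_bigr => i _.
by rewrite pp' -1?ltnS // qq' ?leq_subr.
Qed.

Lemma coef_fps_mul N f g i :
  (i <= N)%N -> fps_mul f g i = (fps_trunc N f * fps_trunc N g)`_i.
Proof.
move=> iN; apply: eq_coefM => j ji;
  by rewrite !coef_fps_trunc // (leq_trans ji).
Qed.

Lemma fps_mulE f g n : fps_mul f g n = \sum_(i < n.+1) f i * g (n - i)%N.
Proof.
rewrite /fps_mul coefM; apply: eq_bigr => i _.
by rewrite !coef_fps_trunc ?leq_subr // -ltnS.
Qed.

Fact fps_mulA : associative fps_mul.
Proof.
move=> f g h; apply/funext => n.
transitivity ((fps_trunc n f * (fps_trunc n g * fps_trunc n h))`_n).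
  apply: eq_coefM => i le_in //.
  by rewrite coef_fps_trunc // (coef_fps_mul _ _ le_in).
rewrite mulrA; apply: eq_coefM => i le_in //.
by rewrite coef_fps_trunc // (coef_fps_mul _ _ le_in).
Qed.

Fact fps_mulC : commutative fps_mul.
Proof. by move=> f g; apply/funext => n; rewrite /fps_mul mulrC. Qed.

Fact fps_mul1 : left_id (fps_of 1) fps_mul.
Proof.
move=> f; apply/funext => n; rewrite fps_mulE big_ord_recl /= /fps_of coef1.
by rewrite mul1r subn0 big1 ?addr0 // => i _; rewrite coef1 mul0r.
Qed.

Fact fps_mulDl : left_distributive fps_mul +%R.
Proof.
move=> f g h; apply/funext => n; rewrite fpsD !fps_mulE -big_split.
by apply: eq_bigr => i _; rewrite fpsD mulrDl.
Qed.

Fact fps_oner_neq0 : fps_of 1 != 0.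
Proof.
apply/eqP => /(congr1 (fun f : fps R => f 0%N)); rewrite /fps_of coef1.
by move/eqP; rewrite oner_eq0.
Qed.

HB.instance Definition _ := GRing.Zmodule_isComNzRing.Build (fps R)
  fps_mulA fps_mulC fps_mul1 fps_mulDl fps_oner_neq0.

Lemma fps1 n : (1 : fps R) n = (n == 0%N)%:R. Proof. exact: coef1. Qed.

Lemma fpsM f g n : (f * g) n = \sum_(i < n.+1) f i * g (n - i)%N.
Proof. exact: fps_mulE. Qed.

Fact fps_scaleAl a f g : a *: (f * g) = (a *: f) * g.
Proof.
apply/funext => n; rewrite fpsZ !fpsM mulr_sumr.
by apply: eq_bigr => i _; rewrite fpsZ mulrA.
Qed.

HB.instance Definition _ := GRing.Lmodule_isLalgebra.Build R (fps R) fps_scaleAl.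
HB.instance Definition _ := GRing.Lalgebra_isComAlgebra.Build R (fps R).

Fact fps_of_is_zmod_morphism : zmod_morphism fps_of.
Proof. by move=> p q; apply/funext => n; rewrite /fps_of coefB. Qed.

Fact fps_of_is_monoid_morphism : monoid_morphism fps_of.
Proof.
by split=> // p q; apply/funext => n; rewrite fpsM /fps_of coefM.
Qed.

HB.instance Definition _ :=
  GRing.isZmodMorphism.Build {poly R} (fps R) fps_of fps_of_is_zmod_morphism.
HB.instance Definition _ :=
  GRing.isMonoidMorphism.Build {poly R} (fps R) fps_of fps_of_is_monoid_morphism.

Definition fpsX : fps R := fps_of 'X.

Lemma fpsXM f n : (fpsX * f) n = if n is n'.+1 then f n' else 0.
Proof.
rewrite fpsM big_ord_recl /= /fpsX {1}/fps_of coefX mul0r add0r.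
case: n => [|n]; first by rewrite big_ord0.
rewrite big_ord_recl /= /fps_of coefX mul1r subSS subn0.
by rewrite big1 ?addr0 // => i _; rewrite coefX mul0r.
Qed.

Lemma fpsXnM N f n : (fpsX ^+ N * f) n = if (n < N)%N then 0 else f (n - N)%N.
Proof.
elim: N n => [|N IHN] n; first by rewrite mul1r subn0.
by rewrite exprS -mulrA fpsXM; case: n => // n; rewrite IHN ltnS subSS.
Qed.

Definition fps_shift N f : fps R := fun n => f (n + N)%N.

Lemma fpsXn_dvd N f :
  (forall n, (n < N)%N -> f n = 0) -> f = fpsX ^+ N * fps_shift N f.
Proof.
move=> f0; apply/funext => n; rewrite fpsXnM.
by case: ltnP => [/f0//|Nn]; rewrite /fps_shift subnK.
Qed.

Lemma fpsX_inj : injective ( *%R fpsX).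
Proof.
move=> f g fg; apply/funext => n.
by have /(congr1 (fun h : fps R => h n.+1)) := fg; rewrite !fpsXM.
Qed.

Lemma fps_split f : f = (f 0%N)%:A + fpsX * fps_shift 1 f.
Proof.
apply/funext => n; rewrite fpsD fpsXM fpsZ fps1.
by case: n => [|n]; rewrite ?mulr1 ?addr0 // mulr0 add0r /fps_shift addn1.
Qed.

(* [t d/dt] *)
Definition fps_theta f : fps R := fun n => f n *+ n.

Lemma fps_thetaD f g : fps_theta (f + g) = fps_theta f + fps_theta g.
Proof. by apply/funext => n; rewrite /fps_theta !fpsD mulrnDl. Qed.

Lemma fps_theta_const a : fps_theta a%:A = 0.
Proof.
apply/funext => -[//|n]; rewrite /fps_theta fpsZ fps1.
by rewrite mulr0 mul0rn.
Qed.

Lemma fps_thetaXM f : fps_theta (fpsX * f) = fpsX * (f + fps_theta f).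
Proof.
apply/funext => n; rewrite /fps_theta !fpsXM.
by case: n => // n; rewrite fpsD mulrS.
Qed.

(** The inverse is the geometric series of h = t f: as h^i has no term below t^i, its coefficient n
    involves only the h^i with i <= n. *)
Lemma fps_inv1B f : exists g, (1 - fpsX * f) * g = 1.
Proof.
pose h := fpsX * f; rewrite -/h.
have hX i n : (n < i)%N -> (h ^+ i) n = 0.
  by move=> n_lt; rewrite /h exprMn fpsXnM n_lt.
have fps_sum I (r : seq I) (F : I -> fps R) n :
    (\sum_(i <- r) F i) n = \sum_(i <- r) F i n.
  by elim/big_ind2: _ => // u a v b <- <-.
exists (fun n => (\sum_(i < n.+1) h ^+ i) n); apply/funext => n.
(* Through degree n the series may be replaced by its partial sum up to h^n, whose product with 1 -
   h is 1 - h^(n+1). *)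
transitivity (((1 - h) * \sum_(i < n.+1) h ^+ i) n); last first.
  by rewrite -opprB mulNr -subrX1 opprB fpsD fpsN hX // subr0.
rewrite !fpsM; apply: eq_bigr => j _; congr (_ * _).
have := leq_subr j n; move: (n - j)%N => i le_in.
rewrite !fps_sum (big_ord_widen n.+1 (fun l => (h ^+ l) i)) ?ltnS //.
rewrite big_mkcond /=; apply: eq_bigr => l _.
by case: ltnP => // /hX ->.
Qed.

End PowerSeriesRing.

Arguments fpsX {R}.

(** * Power series over a field *)

Section PowerSeriesField.
Variable K : fieldType.
Implicit Types f g : fps K.

Lemma fps_unit f : f 0%N != 0 -> exists g, f * g = 1.
Proof.
move=> f0; have [g fg] := fps_inv1B (- (f 0%N)^-1 *: fps_shift 1 f).
exists ((f 0%N)^-1 *: g); rewrite -scalerAr scalerAl -fg; congr (_ * _).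
rewrite {2}[f]fps_split scalerDr scalerA mulVf // scale1r.
by rewrite scaleNr mulrN opprK scalerAr.
Qed.

Lemma fps_uniformizer : uniformizer (fpsX : fps K).
Proof.
split=> [w|n|f].
- apply/eqP => /(congr1 (fun f : fps K => f 0%N)); rewrite fpsXM => /esym/eqP.
  by rewrite fps1 oner_eq0.
- apply/eqP => /(congr1 (fun f : fps K => f n)); rewrite -[_ ^+ _]mulr1 fpsXnM.
  by rewrite ltnn subnn fps1 => /eqP; rewrite oner_eq0.
move=> f_neq0; have : exists n, f n != 0.
  apply: contra_neqP f_neq0 => f0; apply/funext => n.
  by apply/eqP/negP => /negP fn; apply: f0; exists n.
(* [n] is the t-adic order of [f], so the quotient by t^n has the nonzero constant term [f n]. *)
case/ex_minnP=> n fn n_min; exists n, (fps_shift n f).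
have [|w vw] := @fps_unit (fps_shift n f); first by rewrite /fps_shift add0n.
exists w; split=> //; apply: fpsXn_dvd => i i_lt; apply/eqP.
by apply: contraTT i_lt; rewrite -leqNgt; apply: n_min.
Qed.

Lemma fps_mulf_eq0 f g : f * g = 0 -> f = 0 \/ g = 0.
Proof. exact: uniformizer_domain fps_uniformizer f g. Qed.

End PowerSeriesField.

(* The sets [k[[t]] :&: L] with [k(t) <= L] a subfield of [k((t))]. *)
Record saturated (K : fieldType) (S : {pred fps K}) : Prop := Saturated {
  saturated_subalg : subalg_closed S;
  saturated_X : fpsX \in S;
  saturated_div : forall f g, f != 0 -> f \in S -> f * g \in S -> g \in S
}.

(** * Algebras cut out of the power series by a saturated subset *)

Section SaturatedSubalgebra.
Variables (K : fieldType) (S : {pred fps K}).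
Hypothesis S_sat : saturated S.

HB.instance Definition _ :=
  GRing.isSubalgClosed.Build K (fps K) S (saturated_subalg S_sat).

Record satalg : Type := SatAlg {
  satalg_val :> fps K;
  satalgP : satalg_val \in S
}.

HB.instance Definition _ := [isSub for satalg_val].
HB.instance Definition _ := [Choice of satalg by <:].
HB.instance Definition _ := [SubChoice_isSubComNzRing of satalg by <:].
HB.instance Definition _ := [SubZmodule_isSubLmodule of satalg by <:].
HB.instance Definition _ := [SubNzRing_SubLmodule_isSubLalgebra of satalg by <:].
HB.instance Definition _ := [SubLalgebra_isSubAlgebra of satalg by <:].
Local Notation R := (satalg : comAlgType K).

Definition satalgX : R := SatAlg (saturated_X S_sat).

(** The unit factor v = f / t^n and its inverse are quotients of elements of [S], so saturation
    keeps the factorization found in k[[t]] inside [S]. *)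
Lemma satalg_uniformizer : uniformizer satalgX.
Proof.
have [tV tX tf] := fps_uniformizer K.
have valX n : \val (satalgX ^+ n) = fpsX ^+ n by rewrite rmorphXn.
split=> [w|n|f f_neq0].
- by apply: contraNneq (tV (\val w)) => /(congr1 val)/= <-.
- by apply: contraNneq (tX n) => /(congr1 val); rewrite valX => ->.
have [|n [v [w [def_f vw]]]] := tf (\val f).
  by apply: contraNneq f_neq0 => f0; apply/eqP/val_inj.
have vS : v \in S.
  apply: saturated_div (tX n) _ _ => //; last by rewrite -def_f satalgP.
  by rewrite -valX satalgP.
have wS : w \in S.
  apply: saturated_div vS _ => //; last by rewrite vw rpred1.
  by apply: contra_eq_neq vw => ->; rewrite mul0r eq_sym oner_neq0.
exists n, (SatAlg vS), (SatAlg wS).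
by split; apply: val_inj => //; rewrite rmorphM /= valX.
Qed.

(* Writing [f = c + t g], the defect [t D(f) - D(t) theta(f)] is [t] times    *)
(* that of [g], hence divisible by all powers of [t].                        *)
Lemma satalg_derivation (D : R -> R) (f : R) : derivation D ->
  fpsX * \val (D f) = \val (D satalgX) * fps_theta (\val f).
Proof.
move=> [D_lin D_mul]; apply/eqP; rewrite -subr_eq0; apply/eqP/funext => n.
have D1 : D 1 = 0.
  have /eqP := D_mul 1 1.
  by rewrite !mul1r -subr_eq0 opprD addNKr oppr_eq0 => /eqP.
have defect f' : exists g : R,
    fpsX * \val (D f') - \val (D satalgX) * fps_theta (\val f') =
    fpsX * (fpsX * \val (D g) - \val (D satalgX) * fps_theta (\val g)).
  have gS : fps_shift 1 (\val f') \in S.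
    apply: (saturated_div S_sat) (saturated_X S_sat) _.
      by have [_ tX _] := fps_uniformizer K; apply: (tX 1%N).
    have -> : fpsX * fps_shift 1 (\val f') = \val f' - (\val f' 0%N)%:A.
      by rewrite {2}[\val f']fps_split addrAC subrr add0r.
    by rewrite rpredB ?satalgP // rpredZ ?rpred1.
  pose g : R := SatAlg gS; exists g.
  have def_f : f' = (\val f' 0%N)%:A + satalgX * g.
    by apply: val_inj; exact: fps_split.
  have DfE : D f' = satalgX * D g + g * D satalgX.
    by rewrite {1}def_f D_lin D1 scaler0 add0r D_mul.
  rewrite DfE [\val f']fps_split fps_thetaD fps_theta_const add0r fps_thetaXM.
  by rewrite rmorphD !rmorphM /=; ring.
elim: n f => [|n IHn] f; have [g ->] := defect f; rewrite fpsXM //; exact: IHn.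
Qed.

(** If D(t) were nonzero, D(t) theta(u) = t D(u) in [S] would put theta(u) in [S] by saturation. So
    D(t) = 0, whence t D(f) = 0 for all f. *)
Lemma satalg_no_derivation (u : fps K) : u \in S -> fps_theta u \notin S ->
  forall D : R -> R, derivation D -> D =1 \0.
Proof.
move=> uS thetaS D D_der f; apply: val_inj; apply: fpsX_inj.
rewrite satalg_derivation // [RHS]mulr0.
suff -> : D satalgX = 0 by rewrite mul0r.
apply: contraNeq thetaS => DX0.
apply: (saturated_div S_sat) (satalgP (D satalgX)) _.
  by apply: contraNneq DX0 => DX0; apply/eqP/val_inj.
rewrite -(satalg_derivation (SatAlg uS) D_der).
by rewrite rpredM ?satalgP ?(saturated_X S_sat).
Qed.

Lemma saturated_trivial_diffops (u : fps K) : u \in S -> fps_theta u \notin S ->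
  exists R : comAlgType K,
    [/\ regular_local R,
        exists2 d, krull_dim R d & (0 < d)%N,
        forall (n : nat) (f : R -> R), diffop_order n f -> diffop_order 0 f &
        bijective (@diffop_of K R : {rmorphism R -> diffop R})].
Proof.
move=> uS thetaS; exists R; split.
- exact: uniformizer_regular_local satalg_uniformizer.
- by exists 1%N => //; exact: uniformizer_krull_dim satalg_uniformizer.
- by apply: diffop_order_no_derivation; exact: satalg_no_derivation uS thetaS.
by apply: diffop_of_no_derivation_bij; exact: satalg_no_derivation uS thetaS.
Qed.

End SaturatedSubalgebra.

(** * Polynomials over k[t] evaluated at power series *)

Section LacunarySeries.
Variable K : fieldType.
Implicit Types (p P Q : {poly {poly K}}) (f g : fps K) (n m : nat).

(** Here [p] lies in k[t][Y], and the value is taken at Y = f in k[[t]]. *)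
Definition fps_eval p f : fps K := (map_poly (@fps_of K) p).[f].

Lemma fps_eval_of p (q : {poly K}) : fps_eval p (fps_of q) = fps_of p.[q].
Proof. by rewrite /fps_eval horner_map. Qed.

(** Evaluation respects congruence modulo t^N, which carries relations between series over to their
    truncations. *)
Lemma fps_eval_cong N p f g h :
    f = g + fpsX ^+ N * h ->
  exists h', fps_eval p f = fps_eval p g + fpsX ^+ N * h'.
Proof.
move=> ->; elim/poly_ind: p => [|p c [h' IHp]].
  by exists 0; rewrite /fps_eval rmorph0 !horner0 mulr0 addr0.
exists (h' * g + (fps_eval p g + fpsX ^+ N * h') * h).
have evalE x : fps_eval (p * 'X + c%:P) x = fps_eval p x * x + fps_of c.
  by rewrite /fps_eval rmorphD rmorphM /= map_polyX map_polyC hornerMXaddC.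
by rewrite !evalE IHp; ring.
Qed.

Lemma size_horner_leq p (q : {poly K}) c d :
    (forall i, (size (p`_i)%R <= c)%N) -> (size q <= d.+1)%N ->
  (size p.[q] <= c + size p * d)%N.
Proof.
move=> p_le q_le; rewrite horner_coef; apply: (leq_trans (size_sum _ _ _)).
apply/bigmax_leqP => i _; have [->|pi0] := eqVneq p`_i 0.
  by rewrite mul0r size_poly0.
apply: (leq_trans (size_polyMleq _ _)).
have : ((size q).-1 * i <= size p * d)%N.
  by rewrite mulnC; apply: leq_mul; [exact: ltnW | lia].
have := p_le i; have := size_poly_exp_leq q i.
move: ((size q).-1 * i)%N (size p * d)%N (size (q ^+ i)) (size (p`_i)%R) => *.
lia.
Qed.

(** Uniqueness of digits in base s: if p = p' Y + c, then p'(s) s = -c has smaller degree than s,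
    which forces p'(s) = 0 and c = 0. *)
Lemma horner_small_coef_eq0 p (s : {poly K}) :
  (forall i, (size (p`_i)%R < size s)%N) -> p.[s] = 0 -> p = 0.
Proof.
elim/poly_ind: p => // p c IHp p_lt; rewrite !hornerE => ps0.
have c_lt : (size c < size s)%N.
  by have := p_lt 0%N; rewrite coefD coefMX coefC add0r.
have ps : p.[s] = 0.
  apply: contraTeq c_lt => ps_neq0; rewrite -leqNgt.
  have -> : c = - (p.[s] * s) by apply/eqP; rewrite -addr_eq0 addrC ps0.
  have [->|s0] := eqVneq s 0; first by rewrite size_poly0.
  rewrite size_polyN size_mul //.
  move: ps_neq0; rewrite -size_poly_gt0.
  by case: (size p.[s]) => // a _; apply: leq_addl.
have p0 : p = 0.
  by apply: IHp ps => i; have := p_lt i.+1; rewrite coefD coefMX coefC addr0.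
by move: ps0; rewrite ps p0 !mul0r !add0r => ->.
Qed.

(** * The lacunary series u and its truncations *)

(** The factorial makes the ratios of consecutive exponents unbounded; the summand [n] makes the
    gaps n! n + 1, which equal 1 in characteristic p once n >= p. *)
Definition lac_exp n : nat := (n`! + n)%N.

Lemma lac_expS n : lac_exp n.+1 = (lac_exp n + (n`! * n).+1)%N.
Proof. by rewrite /lac_exp factS; lia. Qed.

Lemma leq_lac_exp n m : (n <= m)%N -> (lac_exp n <= lac_exp m)%N.
Proof.
move=> /subnK <-; elim: (m - n)%N => // d IHd.
by rewrite addSn lac_expS (leq_trans IHd) // leq_addr.
Qed.

Lemma ltn_lac_exp n : (n < lac_exp n)%N.
Proof. by rewrite /lac_exp; have := fact_gt0 n; lia. Qed.

(** From n <= n! follows [lac_exp n] <= 2 n!, and 2 c n! <= n n! <= (n+1)!. *)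
Lemma lac_exp_growth c n : (c.*2 <= n)%N -> (c * lac_exp n <= lac_exp n.+1)%N.
Proof.
move=> le_cn; rewrite /lac_exp factS; have /= := ltn_lac_exp n.
have : (n <= n`!)%N.
  by case: n {le_cn} => // n; rewrite factS leq_pmulr ?fact_gt0.
nia.
Qed.

Definition lac_trunc n : {poly K} := \sum_(i < n) 'X^(lac_exp i).

(** As m < [lac_exp m], the terms left out of [lac_trunc m] do not reach t^m. *)
Definition lac_series : fps K := fun m => (lac_trunc m)`_m.

Lemma lac_truncS n : lac_trunc n.+1 = lac_trunc n + 'X^(lac_exp n).
Proof. by rewrite /lac_trunc big_ord_recr. Qed.

Lemma size_lac_trunc_leq n : (size (lac_trunc n) <= lac_exp n)%N.
Proof.
elim: n => [|n IHn]; first by rewrite /lac_trunc big_ord0 size_poly0.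
rewrite lac_truncS (leq_trans (size_polyD _ _)) // size_polyXn geq_max lac_expS.
by apply/andP; split; lia.
Qed.

Lemma size_lac_truncS n : size (lac_trunc n.+1) = (lac_exp n).+1.
Proof.
rewrite lac_truncS addrC size_polyDl size_polyXn // ltnS.
exact: size_lac_trunc_leq.
Qed.

Lemma coef_lac_trunc n N m :
  (n <= N)%N -> (m < lac_exp n)%N -> (lac_trunc N)`_m = (lac_trunc n)`_m.
Proof.
move=> /subnK <- m_lt; elim: (N - n)%N => // d IHd.
rewrite addSn lac_truncS coefD IHd coefXn.
have := leq_lac_exp (leq_addl d n).
by case: eqP m_lt => [->|_ _ _]; [rewrite ltnNge => /negPf-> | rewrite addr0].
Qed.

Lemma lac_seriesE n m : (m < lac_exp n)%N -> lac_series m = (lac_trunc n)`_m.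
Proof.
move=> m_lt; rewrite /lac_series; have [mn|/ltnW nm] := leqP m n.
  by rewrite (coef_lac_trunc mn) // ltn_lac_exp.
exact: coef_lac_trunc.
Qed.


(** Modulo t^(lac_exp n), u and theta(u) agree with s = [lac_trunc n] and t s', so the relation
    passes to s. *)
Lemma lac_series_theta_horner P Q n :
    fps_eval Q lac_series * fps_theta lac_series = fps_eval P lac_series ->
  forall m, (m < lac_exp n)%N ->
    ('X * (lac_trunc n)^`() * Q.[lac_trunc n] - P.[lac_trunc n])`_m = 0.
Proof.
move=> eqQP m m_lt; set s := lac_trunc n; set N := lac_exp n.
have cong (f g : fps K) : (forall i, (i < N)%N -> f i = g i) ->
    exists h, f = g + fpsX ^+ N * h.
  move=> fg; exists (fps_shift N (f - g)); rewrite -fpsXn_dvd ?subrKC //.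
  by move=> i /fg fgi; rewrite fpsD fpsN fgi subrr.
have [h def_s] : exists h, fps_of s = lac_series + fpsX ^+ N * h.
  by apply: cong => i i_lt; rewrite (lac_seriesE i_lt).
have [w def_w] : exists h,
    fps_of ('X * s^`()) = fps_theta lac_series + fpsX ^+ N * h.
  apply: cong => i i_lt; rewrite /fps_of /fps_theta (lac_seriesE i_lt) coefXM.
  by case: i i_lt => // i _; rewrite coef_deriv.
have [q def_q] := fps_eval_cong Q def_s.
have [p def_p] := fps_eval_cong P def_s.
(* The cofactor of t^N in (theta(u) + t^N w) (Q(u) + t^N q) - (P(u) + t^N p), given that Q(u)
   theta(u) = P(u). *)
pose a := (fps_theta lac_series * q + w * fps_eval Q lac_series
           + fpsX ^+ N * w * q - p).
suff : fps_of ('X * s^`() * Q.[s] - P.[s]) = fpsX ^+ N * a.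
  by move/(congr1 (fun f : fps K => f m)); rewrite fpsXnM m_lt.
rewrite rmorphB rmorphM /= -!fps_eval_of def_w def_q def_p -eqQP /a; ring.
Qed.

Lemma size_theta_sub_leq (p : {poly K}) n :
  (size ('X * p^`() - n%:R * p)%R <= size p)%N.
Proof.
apply/leq_sizeP => i i_ge; rewrite coefB coefXM mulr_natl coefMn coef_deriv.
rewrite [p`_i]nth_default // mul0rn subr0.
by case: i i_ge => // i i_ge; rewrite nth_default ?mul0rn.
Qed.

(* Modulo [t^(lac_exp n.+1)] the relation holds for the truncations           *)
(* [s = lac_trunc n.+1] and [t s' = lac_exp n * s + r], where [r] depends only *)
(* on [lac_trunc n]. For large [n] the degrees are too small for a nonzero    *)
(* remainder, and [s] has larger degree than every coefficient of             *)
(* [(lac_exp n Y + r) Q - P], which thus vanishes as a polynomial in [Y].     *)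
Lemma lac_series_theta_linear P Q :
    fps_eval Q lac_series * fps_theta lac_series = fps_eval P lac_series ->
  exists N, forall n, (N <= n)%N -> exists r : {poly K},
    ((lac_exp n)%:R * 'X + r%:P) * Q = P.
Proof.
move=> eqQP; pose c := (sizeY P + sizeY Q + size P + size Q)%N.
exists (c.+4).*2 => -[//|n] n_ge; pose e := lac_exp n.+1.
(* In the code [s] is the shorter truncation. With S = [lac_trunc n.+2] = s + t^e, one has t S' = e
   S + r. *)
pose s := lac_trunc n.+1.
pose r := 'X * s^`() - e%:R * s; exists r.
pose H := (e%:R * 'X + r%:P) * Q - P.
suff : H = 0 by move/eqP; rewrite subr_eq0 => /eqP.
have size_r : (size r <= lac_exp n + 1)%N.
  by rewrite addn1 -size_lac_truncS size_theta_sub_leq.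
have c_lt : (c + lac_exp n + 1 <= e)%N.
  have := @lac_exp_growth 2 n; have := ltn_lac_exp n.
  rewrite /e; lia.
have Pe : (sizeY P <= e)%N by rewrite /c in c_lt; lia.
have Qe : (lac_exp n + 1 + sizeY Q <= e)%N by rewrite /c in c_lt; lia.
have H_lt i : (size (H`_i)%R <= e)%N.
  rewrite coefB mulrDl coefD coefCM -mulrA mulr_natl coefMn coefXM.
  apply: (leq_trans (size_polyD _ _)); rewrite size_polyN geq_max; apply/andP.
  split; last exact: leq_trans (max_size_coefXY P i) Pe.
  apply: (leq_trans (size_polyD _ _)); rewrite geq_max; apply/andP; split.
    case: ifP => _; first by rewrite mul0rn size_poly0.
    rewrite -mulr_natl -polyC_natr mul_polyC.
    apply: (leq_trans (size_scale_leq _ _)); apply: leq_trans Qe.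
    exact: leq_trans (max_size_coefXY Q i.-1) (leq_addl _ _).
  apply: (leq_trans (size_polyMleq _ _)); apply: (leq_trans (leq_pred _)).
  exact: leq_trans (leq_add size_r (max_size_coefXY Q i)) Qe.
have Pc : (size P <= c + 2)%N by rewrite /c; lia.
have Qc : (2 + size Q <= c + 2)%N by rewrite /c; lia.
have size_H : (size H <= c + 2)%N.
  apply: (leq_trans (size_polyD _ _)); rewrite size_polyN geq_max; apply/andP.
  split; last exact: Pc.
  apply: (leq_trans (size_polyMleq _ _)); apply: (leq_trans (leq_pred _)).
  suff A2 : (size (e%:R * 'X + r%:P : {poly {poly K}})%R <= 2)%N.
    exact: leq_trans (leq_add A2 (leqnn _)) Qc.
  by rewrite -polyC_natr size_MXaddC; case: ifP; rewrite // ltnS size_polyC_leq1.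
apply: (@horner_small_coef_eq0 _ (lac_trunc n.+2)) => [i|].
  by rewrite size_lac_truncS ltnS.
have Hs : H.[lac_trunc n.+2] = 'X * (lac_trunc n.+2)^`() * Q.[lac_trunc n.+2]
                               - P.[lac_trunc n.+2].
  rewrite /H !hornerE; congr (_ * _ - _); rewrite /r lac_truncS -/s -/e.
  rewrite derivD derivXn -polyC_natr !hornerE.
  have -> : 'X^e = 'X * 'X^(e.-1) :> {poly K}.
    by rewrite -exprS prednK // (leq_trans _ (ltn_lac_exp _)).
  have ringE (a x y z w : {poly K}) :
    a * (z + x * y) + x * w - a * z = x * (w + a * y) by ring.
  by rewrite -['X^_ *+ _]mulr_natl; exact: ringE.
(* H(S) has no term below t^(lac_exp n.+2) by the congruence, while its size is at most e + (c + 2)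
   e <= [lac_exp n.+2] by the growth of the exponents. *)
apply/polyP => i; rewrite coef0 Hs.
have [i_lt|i_ge] := ltnP i (lac_exp n.+2); first exact: lac_series_theta_horner.
apply: nth_default; apply: leq_trans i_ge; rewrite -Hs.
apply: (leq_trans (size_horner_leq (d := e) H_lt _)).
  by rewrite size_lac_truncS.
apply: leq_trans (@lac_exp_growth (c + 3) n.+1 _); last by lia.
by rewrite -mulSn -/e leq_mul // addnS ltnS.
Qed.

Lemma lac_series_theta P Q :
    fps_eval Q lac_series * fps_theta lac_series = fps_eval P lac_series ->
  Q = 0.
Proof.
move=> /lac_series_theta_linear[N PE]; apply/eqP/negPn/negP => Q0.
have eq_exp n : (N <= n)%N -> (n`! * n).+1%:R = 0 :> K.
  move=> Nn; have [r rP] := PE n Nn; have [r' r'P] := PE n.+1 (leqW Nn).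
  (* Once Q is cancelled, the coefficients of Y give [lac_exp n.+1] = [lac_exp n] in K; the
     difference of the two exponents is n! n + 1. *)
  have /(mulIf Q0)/(congr1 (fun p : {poly {poly K}} => p`_1)) :=
    etrans r'P (esym rP).
  rewrite -!polyC_natr !coefD !coefMX !coefC /= !addr0.
  move=> /polyC_inj/eqP.
  by rewrite lac_expS natrD -subr_eq0 addrAC subrr add0r => /eqP.
(* [M = 0] in [K] with [M] dividing [(max M N)!], so [1 = 0] in [K]. *)
pose M := (N`! * N).+1; have M0 : M%:R = 0 :> K by apply: eq_exp.
have /dvdnP[d def_d] : (M %| (maxn M N)`! * maxn M N)%N.
  by rewrite dvdn_mulr // dvdn_fact // leq_maxl.
have := eq_exp _ (leq_maxr M N); rewrite -addn1 natrD def_d natrM M0 mulr0 add0r.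
by move/eqP; rewrite oner_eq0.
Qed.

(** * The intersection of k[[t]] with k(t, u) *)

(** The condition f = P(u) / Q(u) is cleared of denominators so that it can be stated inside
    k[[t]]. *)
Definition lac_subalg : {pred fps K} := fun f =>
  `[< exists P Q, fps_eval Q lac_series != 0 /\
                  fps_eval Q lac_series * f = fps_eval P lac_series >].

Lemma lac_subalgP f :
  reflect (exists P Q, fps_eval Q lac_series != 0 /\
             fps_eval Q lac_series * f = fps_eval P lac_series)
          (f \in lac_subalg).
Proof. exact: asboolP. Qed.

Lemma fps_evalM P Q f : fps_eval (P * Q) f = fps_eval P f * fps_eval Q f.
Proof. by rewrite /fps_eval rmorphM hornerM. Qed.

Lemma fps_evalD P Q f : fps_eval (P + Q) f = fps_eval P f + fps_eval Q f.
Proof. by rewrite /fps_eval rmorphD hornerD. Qed.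

Lemma fps_evalC (q : {poly K}) f : fps_eval q%:P f = fps_of q.
Proof. by rewrite /fps_eval map_polyC hornerC. Qed.

Lemma fps_evalX f : fps_eval 'X f = f.
Proof. by rewrite /fps_eval map_polyX hornerX. Qed.

Lemma fps_mulf_neq0 f g : f != 0 -> g != 0 -> f * g != 0.
Proof. by move=> f0 g0; apply/eqP => /fps_mulf_eq0[]; apply/eqP. Qed.

Lemma lac_subalg_eval P : fps_eval P lac_series \in lac_subalg.
Proof.
apply/lac_subalgP; exists P, 1; rewrite fps_evalC rmorph1 mul1r.
by rewrite oner_neq0.
Qed.

Lemma lac_subalg_saturated : saturated lac_subalg.
Proof.
split.
- split=> [|a|].
  + by have := lac_subalg_eval 1; rewrite fps_evalC rmorph1.
  + move=> f g /lac_subalgP[P [Q [Q0 eqf]]] /lac_subalgP[P' [Q' [Q'0 eqg]]].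
    apply/lac_subalgP; exists (a%:P%:P * P * Q' + Q * P'), (Q * Q').
    rewrite fps_evalM fps_mulf_neq0 // fps_evalD !fps_evalM fps_evalC -eqf -eqg.
    have -> : fps_of a%:P = a%:A.
      apply/funext => n; rewrite fpsZ fps1 /fps_of coefC.
      by case: n => [|n] /=; rewrite ?mulr1 ?mulr0.
    by split=> //; rewrite -[a *: f]mulr_algl; move: a%:A => b; ring.
  move=> f g /lac_subalgP[P [Q [Q0 eqf]]] /lac_subalgP[P' [Q' [Q'0 eqg]]].
  apply/lac_subalgP; exists (P * P'), (Q * Q'); rewrite !fps_evalM fps_mulf_neq0 //.
  by rewrite -eqf -eqg; split=> //; ring.
- by have := lac_subalg_eval 'X%:P; rewrite fps_evalC.
move=> f g f0 /lac_subalgP[P [Q [Q0 eqf]]] /lac_subalgP[P' [Q' [Q'0 eqfg]]].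
(* g = (f g) / f = Q P' / (Q' P), where P(u) = Q(u) f is nonzero because Q(u) and f are. *)
apply/lac_subalgP; exists (Q * P'), (Q' * P); rewrite !fps_evalM -eqf -eqfg.
by split; [rewrite !fps_mulf_neq0 | ring].
Qed.

Lemma lac_series_in : lac_series \in lac_subalg.
Proof. by have := lac_subalg_eval 'X; rewrite fps_evalX. Qed.

Lemma lac_series_theta_notin : fps_theta lac_series \notin lac_subalg.
Proof.
apply/negP => /lac_subalgP[P [Q [Q0 /lac_series_theta Q_eq0]]].
by move: Q0; rewrite Q_eq0 -polyC0 fps_evalC rmorph0 eqxx.
Qed.

End LacunarySeries.

Theorem theorem1p1 (k : fieldType) :
  exists R : comAlgType k,
    [/\ regular_local R,
        exists2 d, krull_dim R d & (0 < d)%N,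
        forall (n : nat) (f : R -> R), diffop_order n f -> diffop_order 0 f &
        bijective (@diffop_of k R : {rmorphism R -> diffop R})].
Proof.
exact: saturated_trivial_diffops (lac_subalg_saturated k) _
  (lac_series_in k) (lac_series_theta_notin k).
Qed.
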